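(* Let $K$ be an algebraically closed field of characteristic zero, let $G$ be a finite abelian group, and let $A$ be a finite-dimensional cocommutative cosemisimple right Yetter-Drinfel'd Hopf algebra over the group ring $K[G]$. If $\dim(A)>1$, then $A$ contains a trivial Yetter-Drinfel'd Hopf subalgebra $B$ with $\dim(B)>1$.
   Context: Let $H=K[G]$ with $G$ finite abelian (coproduct $g\mapsto g\otimes g$, counit $\varepsilon_H(g)=1$ for $g\in G$). A right Yetter-Drinfel'd module over $H$ is a right $H$-module $V$ that is also a right $H$-comodule, with coaction $\delta(v)=v^{(1)}\otimes v^{(2)}\in V\otimes H$, such that $\delta(v.h)=v^{(1)}.h\otimes v^{(2)}$ for all $h\in H$, $v\in V$. The base field $K$ carries the trivial structures $\xi.h=\varepsilon_H(h)\xi$, $\delta(\xi)=\xi\otimes 1_H$, and tensor products carry the diagonal action and codiagonal coaction. The quasisymmetry is $\sigma_{V,W}:V\otimes W\to W\otimes V$, $v\otimes w\mapsto w^{(1)}\otimes v.w^{(2)}$. A right Yetter-Drinfel'd Hopf algebra over $H$ is a right Yetter-Drinfel'd module $A$ that is an associative unital algebra whose multiplication and unit map are $H$-linear and colinear, and a coalgebra whose coproduct $\Delta_A(a)=a_{(1)}\otimes a_{(2)}$ and counit $\varepsilon_A$ are $H$-linear and colinear, such that $\varepsilon_A:A\to K$ and $\Delta_A:A\to A\hat\otimes A$ are algebra homomorphisms, where $A\hat\otimes A$ is $A\otimes A$ with multiplication $(\mu_A\otimes\mu_A)\circ(\mathrm{id}\otimes\sigma_{A,A}\otimes\mathrm{id})$,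 i.e. $(a\otimes a')(b\otimes b')=ab^{(1)}\otimes(a'.b^{(2)})b'$, and such that there is an $H$-linear and colinear map $S_A:A\to A$ (the antipode) with $S_A(a_{(1)})a_{(2)}=a_{(1)}S_A(a_{(2)})=\varepsilon_A(a)1_A$. Cocommutative means $a_{(1)}\otimes a_{(2)}=a_{(2)}\otimes a_{(1)}$ for all $a\in A$; cosemisimple means that the coalgebra $A$ is a direct sum of simple subcoalgebras. A Yetter-Drinfel'd Hopf subalgebra of $A$ is a unital subalgebra that is also a subcoalgebra, an $H$-submodule and an $H$-subcomodule, and is stable under the antipode. A Yetter-Drinfel'd Hopf algebra $B$ is called trivial if $\sigma_{B,B}(b\otimes b')=b'\otimes b$ for all $b,b'\in B$. *)

(* Defs.v *)
From HB Require Import structures.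
From mathcomp Require Import all_boot all_order all_fingroup all_algebra all_field.

Set Implicit Arguments.
Unset Strict Implicit.
Unset Printing Implicit Defensive.

Import GRing.Theory VectorInternalTheory.
Local Open Scope ring_scope.

(** [tensor V W] is the space of coordinate matrices with respect to the
    reference bases [r2v (delta_mx 0 i)] underlying every [vectType].  The
    lemmas [tens_bilinear], [tlift_linear], [tlift_tens] and [tensor_ext] are
    its universal property: bilinear maps [b] out of [V] and [W] correspond to
    linear maps [tlift b] out of [tensor V W].  In Sweedler notation,
    [tlift (fun x y => E x y) (comul a)] is E(a_(1), a_(2)). *)

Section Tensor.

Variable K : fieldType.

Definition tensor (V W : vectType K) : Type := 'M[K]_(dim V, dim W).

HB.instance Definition _ (V W : vectType K) :=
  Vector.copy (tensor V W) 'M[K]_(dim V, dim W).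

Definition tens (V W : vectType K) (v : V) (w : W) : tensor V W :=
  (v2r v)^T *m v2r w.

Definition tlift (V W U : vectType K) (b : V -> W -> U) (t : tensor V W) : U :=
  \sum_i \sum_j t i j *: b (r2v (delta_mx 0 i)) (r2v (delta_mx 0 j)).

Definition tmap (V W V' W' : vectType K) (f : V -> V') (g : W -> W') :
  tensor V W -> tensor V' W' := tlift (fun v w => tens (f v) (g w)).

Definition tassoc (U V W : vectType K) :
  tensor (tensor U V) W -> tensor U (tensor V W) :=
  tlift (fun (t : tensor U V) (w : W) =>
    tlift (fun u v => tens u (tens v w)) t).

Definition tswap (V W : vectType K) : tensor V W -> tensor W V :=
  tlift (fun v w => tens w v).

(* U (x) U' as a subspace of V (x) W; spanned by all pure tensors by
   [mem_tensv]. *)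
Definition tensv (V W : vectType K) (U : {vspace V}) (U' : {vspace W}) :
  {vspace tensor V W} :=
  <<[seq tens u w | u <- vbasis U, w <- vbasis U']>>%VS.

Lemma tens_bilinear (V W : vectType K) :
  bilinear_for *:%R *:%R (@tens V W).
Proof.
split=> [w|v] a x y; rewrite /tens linearP.
  by rewrite linearP /= mulmxDl -scalemxAl.
by rewrite /= mulmxDr -scalemxAr.
Qed.

Lemma tlift_linear (V W U : vectType K) (b : V -> W -> U) :
  linear (tlift b).
Proof.
move=> a s t; rewrite /tlift scaler_sumr -big_split; apply: eq_bigr => i _.
rewrite scaler_sumr -big_split; apply: eq_bigr => j _ /=.
by rewrite mxE mxE scalerDl scalerA.
Qed.

HB.instance Definition _ (V W U : vectType K) (b : V -> W -> U) :=
  GRing.isLinear.Build K (tensor V W) U *:%R (tlift b) (tlift_linear b).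

Lemma coord_sum (V : vectType K) (v : V) :
  v = \sum_i v2r v 0 i *: r2v (delta_mx 0 i).
Proof.
by rewrite -{1}[v]v2rK {1}[v2r v]row_sum_delta linear_sum; apply: eq_bigr => i _;
  rewrite linearZ.
Qed.

Lemma tlift_tens (V W U : vectType K) (b : V -> W -> U) (v : V) (w : W) :
  bilinear_for *:%R *:%R b -> tlift b (tens v w) = b v w.
Proof.
case=> bl br.
pose fl w' := GRing.isLinear.Build _ _ _ _ (b^~ w') (bl w').
pose Fl w' : {linear V -> U} := HB.pack (b^~ w') (fl w').
pose fr v' := GRing.isLinear.Build _ _ _ _ (b v') (br v').
pose Fr v' : {linear W -> U} := HB.pack (b v') (fr v').
rewrite [in RHS](coord_sum v) -[RHS]/(Fl w _) linear_sum; apply: eq_bigr => i _.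
rewrite linearZ /= [in RHS](coord_sum w) -[X in _ *: X]/(Fr _ _) linear_sum.
rewrite scaler_sumr; apply: eq_bigr => j _; rewrite linearZ /= scalerA.
by rewrite /tens mxE big_ord1 mxE.
Qed.

Lemma tensor_decomp (V W : vectType K) (t : tensor V W) :
  t = \sum_i \sum_j t i j *: tens (r2v (delta_mx 0 i)) (r2v (delta_mx 0 j)).
Proof.
rewrite {1}[t]matrix_sum_delta; apply: eq_bigr => i _; apply: eq_bigr => j _.
by rewrite /tens !r2vK trmx_delta mul_delta_mx.
Qed.

Lemma tensor_ext (V W U : vectType K) (f g : {linear tensor V W -> U}) :
  (forall v w, f (tens v w) = g (tens v w)) -> f =1 g.
Proof.
move=> fg t; rewrite [t]tensor_decomp !linear_sum; apply: eq_bigr => i _.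
by rewrite !linear_sum; apply: eq_bigr => j _; rewrite !linearZ fg.
Qed.

Lemma mem_tensv (V W : vectType K) (U : {vspace V}) (U' : {vspace W}) v w :
  v \in U -> w \in U' -> tens v w \in tensv U U'.
Proof.
case: (tens_bilinear V W) => tl tr.
pose Fl w' : {linear V -> tensor V W} :=
  HB.pack (@tens V W ^~ w') (GRing.isLinear.Build _ _ _ _ (@tens V W ^~ w') (tl w')).
pose Fr v' : {linear W -> tensor V W} :=
  HB.pack (@tens V W v') (GRing.isLinear.Build _ _ _ _ (@tens V W v') (tr v')).
move=> /coord_vbasis-> /coord_vbasis->.
rewrite -[tens _ _]/(Fl _ _) linear_sum; apply: rpred_sum => i _.
rewrite linearZ; apply: rpredZ; rewrite -[Fl _ _]/(Fr _ _) linear_sum.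
apply: rpred_sum => j _; rewrite linearZ; apply: rpredZ; apply: memv_span.
by apply: allpairs_f; apply: mem_nth; rewrite size_tuple.
Qed.

End Tensor.

Section GroupAlgebra.

Variables (K : fieldType) (gT : finGroupType).

Definition grpalg : Type := {ffun gT -> K^o}.

HB.instance Definition _ := Vector.copy grpalg {ffun gT -> K^o}.

Definition grp (g : gT) : grpalg := [ffun x => (x == g)%:R].

Definition grpalg_mul (h h' : grpalg) : grpalg :=
  [ffun x => \sum_y (h y : K) * h' (y^-1 * x)%g].

Fact grpalg_mulA : associative grpalg_mul.
Proof.
move=> a b c; apply/ffunP=> x; rewrite !ffunE.
under eq_bigr => y _ do rewrite ffunE big_distrr /=.
under [RHS]eq_bigr => y _ do rewrite ffunE big_distrl /=.
rewrite [RHS]exchange_big; apply: eq_bigr => y _ /=.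
rewrite [RHS](reindex_inj (mulgI y)); apply: eq_bigr => z _ /=.
by rewrite mulKg invMg mulrA mulgA.
Qed.

Fact grpalg_mul1 : left_id (grp 1%g) grpalg_mul.
Proof.
move=> a; apply/ffunP=> x; rewrite ffunE (bigD1 1%g) //= big1 => [|y ny].
  by rewrite ffunE eqxx mul1r invg1 mul1g addr0.
by rewrite ffunE (negPf ny) mul0r.
Qed.

Fact grpalg_mulr1 : right_id (grp 1%g) grpalg_mul.
Proof.
move=> a; apply/ffunP=> x; rewrite ffunE (bigD1 x) //= big1 => [|y ny].
  by rewrite ffunE mulVg eqxx mulr1 addr0.
by rewrite ffunE -eq_mulVg1 (negPf ny) mulr0.
Qed.

Fact grpalg_mulDl : left_distributive grpalg_mul +%R.
Proof.
move=> a b c; apply/ffunP=> x; rewrite !ffunE -big_split; apply: eq_bigr => y _.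
by rewrite ffunE mulrDl.
Qed.

Fact grpalg_mulDr : right_distributive grpalg_mul +%R.
Proof.
move=> a b c; apply/ffunP=> x; rewrite !ffunE -big_split; apply: eq_bigr => y _.
by rewrite ffunE mulrDr.
Qed.

Fact grpalg_one_neq0 : grp 1%g != 0.
Proof. by apply/eqP=> /ffunP/(_ 1%g)/eqP; rewrite !ffunE eqxx oner_eq0. Qed.

HB.instance Definition _ := GRing.Zmodule_isNzRing.Build grpalg
  grpalg_mulA grpalg_mul1 grpalg_mulr1 grpalg_mulDl grpalg_mulDr
  grpalg_one_neq0.

Fact grpalg_scaleAl (a : K) (u v : grpalg) : a *: (u * v) = a *: u * v.
Proof.
apply/ffunP=> x; rewrite !ffunE scaler_sumr; apply: eq_bigr => y _.
by rewrite ffunE scalerAl.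
Qed.

HB.instance Definition _ :=
  GRing.Lmodule_isLalgebra.Build K grpalg grpalg_scaleAl.

Fact grpalg_scaleAr (a : K) (u v : grpalg) : a *: (u * v) = u * (a *: v).
Proof.
apply/ffunP=> x; rewrite !ffunE scaler_sumr; apply: eq_bigr => y _.
by rewrite ffunE scalerAr.
Qed.

HB.instance Definition _ :=
  GRing.Lalgebra_isAlgebra.Build K grpalg grpalg_scaleAr.

HB.instance Definition _ := Algebra_isFalgebra.Build K grpalg.

Lemma grpM (g g' : gT) : grp g * grp g' = grp (g * g')%g.
Proof.
apply/ffunP=> x; rewrite ffunE (bigD1 g) //= big1 => [|y ny].
  by rewrite !ffunE eqxx mul1r addr0 -(inj_eq (mulgI g)) mulKVg.
by rewrite ffunE (negPf ny) mul0r.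
Qed.

Lemma grpalgE (h : grpalg) : h = \sum_g (h g : K) *: grp g.
Proof.
apply/ffunP=> x; rewrite sum_ffunE (bigD1 x) //= big1 => [|y ny].
  by rewrite !ffunE eqxx addr0 /= [RHS]mulr1.
by rewrite !ffunE eq_sym (negPf ny) [LHS]mulr0.
Qed.

(* The Hopf structure extending g |-> g (x) g and g |-> 1. *)
Definition comulH (h : grpalg) : tensor grpalg grpalg :=
  \sum_g (h g : K) *: tens (grp g) (grp g).

Definition counitH (h : grpalg) : K^o := \sum_g h g.

End GroupAlgebra.

Section YetterDrinfeld.

Variables (K : fieldType) (gT : finGroupType).
Notation H := (grpalg K gT).
Implicit Types U V W : vectType K.

Record ydData V := YDData {
  act : V -> H -> V;
  coact : V -> tensor V H
}.

Record is_ydModule V (X : ydData V) : Prop := IsYDModule {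
  act_bilinear : bilinear_for *:%R *:%R (act X);
  act1 : forall v, act X v 1 = v;
  actM : forall v h h', act X v (h * h') = act X (act X v h) h';
  coact_linear : linear (coact X);
  coact_coassoc : forall v,
    tassoc (tmap (coact X) id (coact X v))
      = tmap id (@comulH K gT) (coact X v);
  coact_counit : forall v,
    tlift (fun v1 (v2 : H) => counitH v2 *: v1) (coact X v) = v;
  coact_act : forall v h,
    coact X (act X v h) = tmap (fun v1 => act X v1 h) id (coact X v)
}.

Definition ydBase : ydData K^o :=
  YDData (fun xi h => counitH h * xi) (fun xi => tens xi (1 : H)).

Definition ydTensor V W (X : ydData V) (Y : ydData W) : ydData (tensor V W) :=
  YDData
    (fun t h =>
       tlift (fun h1 h2 => tmap (act X ^~ h1) (act Y ^~ h2) t) (comulH h))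
    (tlift (fun v w =>
       tlift (fun v1 v2 =>
         tlift (fun w1 w2 => tens (tens v1 w1) (v2 * w2 : H)) (coact Y w))
       (coact X v))).

Definition ydLinear V W (X : ydData V) (Y : ydData W) (f : V -> W) : Prop :=
  linear f /\ forall v h, f (act X v h) = act Y (f v) h.

Definition ydColinear V W (X : ydData V) (Y : ydData W) (f : V -> W) : Prop :=
  forall v, coact Y (f v) = tmap f id (coact X v).

Definition ydMorphism V W (X : ydData V) (Y : ydData W) (f : V -> W) : Prop :=
  ydLinear X Y f /\ ydColinear X Y f.

Definition ydSigma V W (X : ydData V) (Y : ydData W) :
  tensor V W -> tensor W V :=
  tlift (fun v w => tlift (fun w1 w2 => tens w1 (act X v w2)) (coact Y w)).

(* (a (x) a')(b (x) b') = (mu (x) mu)(a (x) sigma(a' (x) b) (x) b'). *)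
Definition hatmul (A : falgType K) (X : ydData A) (s t : tensor A A) :
  tensor A A :=
  tlift (fun a a' =>
    tlift (fun b b' =>
      tmap (fun x => a * x) (fun y => y * b') (ydSigma X X (tens a' b))) t) s.

Record ydHopf (A : falgType K) := YDHopf {
  yd_data :> ydData A;
  comul : {linear A -> tensor A A};
  counit : {linear A -> K^o};
  antipode : A -> A;
  yd_module : is_ydModule yd_data;
  comul_coassoc : forall a,
    tassoc (tmap comul id (comul a)) = tmap id comul (comul a);
  counit_l : forall a, tlift (fun a1 a2 => counit a1 *: a2) (comul a) = a;
  counit_r : forall a, tlift (fun a1 a2 => counit a2 *: a1) (comul a) = a;
  mul_morphism : ydMorphism (ydTensor yd_data yd_data) yd_data
    (tlift (fun a b : A => a * b));
  unit_morphism : ydMorphism ydBase yd_data (fun xi : K^o => (xi : K)%:A);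
  comul_morphism : ydMorphism yd_data (ydTensor yd_data yd_data) comul;
  counit_morphism : ydMorphism yd_data ydBase counit;
  counit1 : counit 1 = 1;
  counitM : forall a b, counit (a * b) = counit a * counit b;
  comul1 : comul 1 = tens 1 1;
  comulM : forall a b, comul (a * b) = hatmul yd_data (comul a) (comul b);
  antipode_morphism : ydMorphism yd_data yd_data antipode;
  antipode_l : forall a,
    tlift (fun a1 a2 => antipode a1 * a2) (comul a) = counit a *: 1;
  antipode_r : forall a,
    tlift (fun a1 a2 => a1 * antipode a2) (comul a) = counit a *: 1
}.

Section Properties.

Variables (A : falgType K) (X : ydHopf A).

Definition cocommutative : Prop := forall a, tswap (comul X a) = comul X a.

Definition subcoalgebra (C : {vspace A}) : Prop :=
  forall c, c \in C -> comul X c \in tensv C C.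

Definition simple_subcoalgebra (C : {vspace A}) : Prop :=
  [/\ subcoalgebra C, C != 0%VS
    & forall D : {vspace A}, subcoalgebra D -> (D <= C)%VS ->
        D = 0%VS \/ D = C].

Definition cosemisimple : Prop :=
  exists (n : nat) (C : 'I_n -> {vspace A}),
    [/\ forall i, simple_subcoalgebra (C i),
        directv (\sum_i C i) & (\sum_i C i)%VS = fullv].

Record ydHopf_sub (B : {vspace A}) : Prop := YDHopfSub {
  ydsub_one : 1 \in B;
  ydsub_mul : forall a b, a \in B -> b \in B -> a * b \in B;
  ydsub_subcoalgebra : subcoalgebra B;
  ydsub_act : forall b h, b \in B -> act X b h \in B;
  ydsub_coact : forall b, b \in B -> coact X b \in tensv B fullv;
  ydsub_antipode : forall b, b \in B -> antipode X b \in B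
}.

(* The structure maps of a Yetter-Drinfel'd Hopf subalgebra B are the
   restrictions of those of A, so sigma_{B,B} is the restriction of
   sigma_{A,A} to B (x) B. *)
Definition yd_trivial (B : {vspace A}) : Prop :=
  forall b b', b \in B -> b' \in B -> ydSigma X X (tens b b') = tens b' b.

End Properties.

End YetterDrinfeld.

(* Main.v *)
From Pilot Require Import Defs.
From HB Require Import structures.
From mathcomp Require Import all_boot all_order all_fingroup all_algebra all_field.
Import GRing.Theory.
Import VectorInternalTheory.
Local Open Scope ring_scope.

Set Implicit Arguments.
Unset Strict Implicit.
Unset Printing Implicit Defensive.

(** Since [K] is algebraically closed, [A] has a basis of group-like elements
    [x], which [G] permutes.  Let [V_x] be the stabilizer of [x] in [G] and
    [D_x] the set of degrees of the nonzero homogeneous components of [x] for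
    the [G]-grading given by the coaction; it is a subgroup.  From
    Delta(xy) = sum_g x y_g (x) (x.g) y one sees that the set C of basis
    elements occurring in [xy] is the same for all (x.g) y with g in [D_y],
    that span(C) = span(x.[D_y]) y, and hence that C has as many elements as
    the orbit x.[D_y].  If 1 is in C then C is [D_y]-stable and [V_x] fixes [y]
    and every element of C.  The orbit of 1 is trivial, so if the orbit of [x]
    is not, every u <> 1 in C has a [D_y]-orbit strictly smaller than that of
    [x], whence [V_u] strictly contains [V_x].  So if x <> 1 has a maximal
    stabilizer V, and y is chosen with 1 in C, then [D_y] is contained in V,
    and the basis elements [p] with [V_p] containing V and [D_p] contained in V
    span a trivial subalgebra containing y <> 1. *)

(** * Slices of tensors and linearity of the tensor constructions *)

Section TensorTheory.

Variable K : fieldType.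
Implicit Types U V W : vectType K.

(** The two partial applications of [tens] are named so that each can carry a linear structure,
    which gives access to [linear_sum], [linearZ] and [linear0]. *)
Definition tensl V W w : V -> tensor V W := fun v => tens v w.
Definition tensr V W v : W -> tensor V W := fun w => tens v w.

HB.instance Definition _ V W w := GRing.isLinear.Build K V (tensor V W) *:%R
  (@tensl V W w) ((tens_bilinear V W).1 w).
HB.instance Definition _ V W v := GRing.isLinear.Build K W (tensor V W) *:%R
  (@tensr V W v) ((tens_bilinear V W).2 v).

Lemma tens_suml V W (I : Type) (r : seq I) (P : pred I) (F : I -> V) (w : W) :
  tens (\sum_(i <- r | P i) F i) w = \sum_(i <- r | P i) tens (F i) w.
Proof. exact: (linear_sum (tensl w)). Qed.

Lemma tens_sumr V W (I : Type) (r : seq I) (P : pred I) (v : V) (F : I -> W) :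
  tens v (\sum_(i <- r | P i) F i) = \sum_(i <- r | P i) tens v (F i).
Proof. exact: (linear_sum (tensr v)). Qed.

Lemma tensZl V W a (v : V) (w : W) : tens (a *: v) w = a *: tens v w.
Proof. by rewrite -[LHS]/(tensl w _) linearZ. Qed.

Lemma tensZr V W a (v : V) (w : W) : tens v (a *: w) = a *: tens v w.
Proof. by rewrite -[LHS]/(tensr v _) linearZ. Qed.

Lemma tens0l V W (w : W) : tens (0 : V) w = 0.
Proof. exact: (linear0 (tensl w)). Qed.

Lemma bilinear_tens V W V' W' (f : V -> V') (g : W -> W') :
  linear f -> linear g -> bilinear_for *:%R *:%R (fun v w => tens (f v) (g w)).
Proof.
move=> lf lg; split=> [w|v] a x y.
  by rewrite lf (tens_bilinear _ _).1.
by rewrite lg (tens_bilinear _ _).2.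
Qed.

Lemma tmap_tens V W V' W' (f : V -> V') (g : W -> W') v w :
  linear f -> linear g -> tmap f g (tens v w) = tens (f v) (g w).
Proof. by move=> lf lg; rewrite /tmap tlift_tens //; apply: bilinear_tens. Qed.

Lemma tmap_linear V W V' W' (f : V -> V') (g : W -> W') : linear (tmap f g).
Proof. exact: tlift_linear. Qed.

HB.instance Definition _ V W V' W' (f : V -> V') (g : W -> W') :=
  GRing.isLinear.Build K (tensor V W) (tensor V' W') *:%R (tmap f g)
    (tmap_linear f g).

Lemma scalar_forZ V (f : V -> K) c x : scalar f -> f (c *: x) = c * f x.
Proof.
(* With coefficient [c - 1] the argument [(c - 1) x + x] is [c x], so homogeneity follows without
   first proving that [f] vanishes at 0. *)
move=> lf; have := lf (c - 1) x x.
by rewrite -{2}[x]scale1r -scalerDl subrK mulrBl mul1r subrK.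
Qed.

Lemma eq_tlift V W U (b b' : V -> W -> U) t :
  (forall v w, b v w = b' v w) -> tlift b t = tlift b' t.
Proof.
by move=> bb'; apply: eq_bigr => i _; apply: eq_bigr => j _; rewrite bb'.
Qed.

(** Linearity of [tlift] in the map being lifted, not in the tensor; needed when one [tlift] is
    nested inside another and the outer variable is a parameter of the inner map. *)
Lemma tlift_funP V W U c (b b1 b2 : V -> W -> U) t :
  (forall v w, b v w = c *: b1 v w + b2 v w) ->
  tlift b t = c *: tlift b1 t + tlift b2 t.
Proof.
move=> bE; rewrite /tlift scaler_sumr -big_split; apply: eq_bigr => i _ /=.
rewrite scaler_sumr -big_split; apply: eq_bigr => j _ /=.
by rewrite bE scalerDr !scalerA mulrC.
Qed.

(* f (x) id and id (x) f, composed with K (x) W = W and V (x) K = V. *)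
Definition slicel V W (f : V -> K) : tensor V W -> W :=
  tlift (fun v w => f v *: w).
Definition slicer V W (f : W -> K) : tensor V W -> V :=
  tlift (fun v w => f w *: v).

HB.instance Definition _ V W f := GRing.isLinear.Build K (tensor V W) W *:%R
  (@slicel V W f) (tlift_linear _).
HB.instance Definition _ V W f := GRing.isLinear.Build K (tensor V W) V *:%R
  (@slicer V W f) (tlift_linear _).

Lemma slicel_tens V W (f : V -> K) v (w : W) :
  scalar f -> slicel f (tens v w) = f v *: w.
Proof.
move=> lf; rewrite /slicel tlift_tens //; split=> [w'|v'] a x y.
  by rewrite lf /= scalerDl scalerA.
by rewrite /= scalerDr !scalerA mulrC.
Qed.

Lemma slicer_tens V W (f : W -> K) (v : V) w :
  scalar f -> slicer f (tens v w) = f w *: v.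
Proof.
move=> lf; rewrite /slicer tlift_tens //; split=> [w'|v'] a x y.
  by rewrite /= scalerDr !scalerA mulrC.
by rewrite lf /= scalerDl scalerA.
Qed.

(** A form of [tensor_ext] for composites that carry no bundled linear structure. *)
Lemma tensor_ext_linear V W U (f g : tensor V W -> U) :
  linear f -> linear g -> (forall v w, f (tens v w) = g (tens v w)) -> f =1 g.
Proof.
move=> lf lg.
pose F : {linear tensor V W -> U} := HB.pack f (GRing.isLinear.Build _ _ _ _ f lf).
pose G : {linear tensor V W -> U} := HB.pack g (GRing.isLinear.Build _ _ _ _ g lg).
exact: (@tensor_ext _ _ _ _ F G).
Qed.

Definition rcoord V (i : 'I_(dim V)) (v : V) : K := v2r v 0 i.

Lemma rcoord_scalar V i : scalar (@rcoord V i).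
Proof. by move=> a x y; rewrite /rcoord linearP !mxE. Qed.

Lemma tensor_slicel V W (t : tensor V W) :
  t = \sum_i tens (r2v (delta_mx 0 i)) (slicel (@rcoord V i) t).
Proof.
apply: (@tensor_ext_linear V W _ id
  (fun t => \sum_i tens (r2v (delta_mx 0 i)) (slicel (@rcoord V i) t))) => //.
  move=> a s s'; rewrite scaler_sumr -big_split; apply: eq_bigr => i _ /=.
  by rewrite linearP (tens_bilinear _ _).2.
move=> v w; rewrite {1}(coord_sum v) tens_suml; apply: eq_bigr => i _.
by rewrite slicel_tens ?tensZl ?tensZr //; apply: rcoord_scalar.
Qed.

Lemma tensor_slicer V W (t : tensor V W) :
  t = \sum_i tens (slicer (@rcoord W i) t) (r2v (delta_mx 0 i)).
Proof.
apply: (@tensor_ext_linear V W _ id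
  (fun t => \sum_i tens (slicer (@rcoord W i) t) (r2v (delta_mx 0 i)))) => //.
  move=> a s s'; rewrite scaler_sumr -big_split; apply: eq_bigr => i _ /=.
  by rewrite linearP (tens_bilinear _ _).1.
move=> v w; rewrite {1}(coord_sum w) tens_sumr; apply: eq_bigr => i _.
by rewrite slicer_tens ?tensZl ?tensZr //; apply: rcoord_scalar.
Qed.

Lemma slicel_swap V W (f : W -> K) (t : tensor V W) :
  scalar f -> slicel f (tswap t) = slicer f t.
Proof.
move=> lf; apply: (@tensor_ext_linear V W V (slicel f \o @tswap K V W)) t.
- by move=> a s t; rewrite /= /tswap !linearP.
- exact: linearP.
move=> v w /=; rewrite /tswap tlift_tens; last first.
  by split=> [w'|v'] a x y; rewrite ((tens_bilinear _ _).1, (tens_bilinear _ _).2).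
by rewrite slicel_tens ?slicer_tens.
Qed.

Lemma tens_neq0 V W (v : V) (w : W) : v != 0 -> w != 0 -> tens v w != 0.
Proof.
move=> v0 w0; apply: contraNneq w0 => t0.
have [i vi]: exists i, rcoord i v != 0.
  apply/existsP; apply: contraNT v0; rewrite negb_exists => /forallP vi.
  rewrite (coord_sum v) big1 // => i _.
  by have:= vi i; rewrite negbK => /eqP; rewrite /rcoord => ->; rewrite scale0r.
have /eqP := slicel_tens v w (@rcoord_scalar V i).
by rewrite t0 linear0 eq_sym scaler_eq0 (negPf vi).
Qed.

(** The projections onto [U] and [U'], applied to the two factors, fix [t]: the second moves only
    the left slices, which lie in [U'], and the first only the right slices, which lie in [U]. The
    image of the combined projection lies in [tensv U U']. *)
Lemma mem_tensv_slices V W (U : {vspace V}) (U' : {vspace W}) t :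
  (forall f : V -> K, scalar f -> slicel f t \in U') ->
  (forall f : W -> K, scalar f -> slicer f t \in U) -> t \in tensv U U'.
Proof.
move=> tl tr.
have tmapP : tmap (projv U) (projv U') t = t.
  have ->: tmap (projv U) (projv U') t
     = tmap (projv U) id (tmap id (projv U') t).
    apply: (@tensor_ext_linear V W _ (tmap (projv U) (projv U'))
      (tmap (projv U) id \o tmap id (projv U'))) => [| |v w]; try exact: linearP.
    by rewrite /= !tmap_tens //; try exact: linearP.
  have ->: tmap id (projv U') t = t.
    rewrite [in LHS](tensor_slicel t) linear_sum [RHS]tensor_slicel.
    apply: eq_bigr => i _; rewrite /= tmap_tens //; last exact: linearP.
    by rewrite projv_id // tl //; apply: rcoord_scalar.
  rewrite [in LHS](tensor_slicer t) linear_sum [RHS]tensor_slicer.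
  apply: eq_bigr => i _; rewrite /= tmap_tens //; last exact: linearP.
  by rewrite projv_id // tr //; apply: rcoord_scalar.
rewrite -tmapP (tensor_slicel t) linear_sum rpred_sum // => i _.
by rewrite /= tmap_tens; [apply: mem_tensv; apply: memv_proj | exact: linearP..].
Qed.

Lemma tensv_slicel V W (U : {vspace V}) (U' : {vspace W}) (f : V -> K) t :
  scalar f -> t \in tensv U U' -> slicel f t \in U'.
Proof.
move=> lf; rewrite /tensv; set s := [seq _ | _ <- _, _ <- _].
rewrite -[s]/(tval (in_tuple s)) => /coord_span ->.
rewrite linear_sum rpred_sum // => i _; rewrite linearZ rpredZ //=.
have /allpairsP[[u w] /= [uU wU ->]] : s`_i \in s by rewrite mem_nth.
by rewrite slicel_tens // rpredZ // vbasis_mem.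
Qed.

Lemma tassoc_tens U V W (u : U) (v : V) (w : W) :
  tassoc (tens (tens u v) w) = tens u (tens v w).
Proof.
have bil (x : W) : bilinear_for *:%R *:%R (fun u v => tens u (tens v x)).
  by apply: bilinear_tens => //; apply: (tens_bilinear _ _).1.
rewrite /tassoc !tlift_tens //; split=> [x|t] c x' y; first exact: linearP.
by apply: tlift_funP => u' v'; rewrite (tens_bilinear _ _).2 (tens_bilinear _ _).2.
Qed.

Lemma tassoc_linear U V W : linear (@tassoc K U V W).
Proof. exact: tlift_linear. Qed.

HB.instance Definition _ U V W := GRing.isLinear.Build K
  (tensor (tensor U V) W) (tensor U (tensor V W)) *:%R (@tassoc K U V W)
  (@tassoc_linear U V W).

End TensorTheory.

(** * Coefficients in the group algebra *)

Section Components.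

Variables (K : fieldType) (gT : finGroupType).
Notation H := (grpalg K gT).
Implicit Types V W : vectType K.

Definition hcoef V (g : gT) : tensor V H -> V :=
  tlift (fun v (h : H) => (h g : K) *: v).

HB.instance Definition _ V g := GRing.isLinear.Build K (tensor V H) V *:%R
  (@hcoef V g) (tlift_linear _).

Lemma hcoef_tens V g (v : V) (h : H) : hcoef g (tens v h) = (h g : K) *: v.
Proof.
rewrite /hcoef tlift_tens //; split=> [h'|v'] a x y /=.
  by rewrite scalerDr !scalerA mulrC.
by rewrite !ffunE scalerDl scalerA.
Qed.

Lemma hcoef_tens_grp V g k (v : V) :
  hcoef g (tens v (grp K k)) = if g == k then v else 0.
Proof. by rewrite hcoef_tens ffunE; case: eqP => _; rewrite ?scale1r ?scale0r. Qed.

Lemma tensor_hcoef V (t : tensor V H) : t = \sum_g tens (hcoef g t) (grp K g).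
Proof.
apply: (@tensor_ext_linear K V _ _ id (fun t => \sum_g tens (hcoef g t) (grp K g))).
- by [].
- move=> a s s'; rewrite scaler_sumr -big_split; apply: eq_bigr => i _ /=.
  by rewrite linearP (tens_bilinear _ _).1.
move=> v h; rewrite {1}(grpalgE h) tens_sumr; apply: eq_bigr => g _.
by rewrite hcoef_tens tensZl tensZr.
Qed.

Lemma hcoef_tmap V W (f : V -> W) g t :
  linear f -> hcoef g (tmap f id t) = f (hcoef g t).
Proof.
move=> lf; pose F : {linear V -> W} := HB.pack f (GRing.isLinear.Build _ _ _ _ f lf).
apply: (@tensor_ext_linear _ _ _ _ (hcoef g \o tmap f id) (F \o hcoef g)) t.
- exact: linearP.
- exact: linearP.
by move=> v h; rewrite /= tmap_tens // !hcoef_tens -[f (_ *: _)]/(F _) linearZ.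
Qed.

Lemma comulH_grp (g : gT) : comulH (grp K g) = tens (grp K g) (grp K g).
Proof.
rewrite /comulH (bigD1 g) //= big1 => [|k kg]; rewrite ffunE.
  by rewrite eqxx scale1r addr0.
by rewrite (negPf kg) scale0r.
Qed.

Lemma hcoef_comulH g (h : H) : hcoef g (comulH h) = (h g : K) *: grp K g.
Proof.
rewrite /comulH linear_sum (bigD1 g) //= big1 => [|k kg]; rewrite linearZ /=.
  by rewrite hcoef_tens_grp eqxx addr0.
by rewrite hcoef_tens_grp eq_sym (negPf kg) scaler0.
Qed.

Lemma counitH_grp (g : gT) : counitH (grp K g) = 1.
Proof.
rewrite /counitH (bigD1 g) //= big1 => [|k kg]; rewrite ffunE ?eqxx ?addr0 //.
by rewrite (negPf kg).
Qed.

Lemma counitH_linear : scalar (@counitH K gT).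
Proof.
move=> a x y; rewrite /counitH big_distrr -big_split; apply: eq_bigr => g _ /=.
by rewrite !ffunE.
Qed.

Lemma comulH_linear : linear (@comulH K gT).
Proof.
move=> a x y; rewrite /comulH scaler_sumr -big_split; apply: eq_bigr => g _ /=.
by rewrite !ffunE scalerDl scalerA.
Qed.

End Components.

(** * The Hopf algebra axioms in terms of group elements and homogeneous components *)

Section YDHopf.

Variables (K : fieldType) (gT : finGroupType) (A : falgType K) (X : ydHopf gT A).
Notation H := (grpalg K gT).
Implicit Types (a b p q : A) (g h k : gT).

Definition grpact g a : A := Defs.act X a (grp K g).
(** A coaction of the group algebra is a grading by the group; this is the projection onto degree
    [g]. *)
Definition hcomp g a : A := hcoef g (coact X a).

Let modX := yd_module X.

Lemma grpact_linear g : linear (grpact g).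
Proof. exact: (act_bilinear modX).1. Qed.

HB.instance Definition _ g := GRing.isLinear.Build K A A *:%R (grpact g)
  (grpact_linear g).

Lemma hcomp_linear g : linear (hcomp g).
Proof. by move=> a x y; rewrite /hcomp (coact_linear modX) linearP. Qed.

HB.instance Definition _ g := GRing.isLinear.Build K A A *:%R (hcomp g)
  (hcomp_linear g).

Lemma actE a (h : H) : Defs.act X a h = \sum_g (h g : K) *: grpact g a.
Proof.
rewrite {1}(grpalgE h).
have lr := (act_bilinear modX).2 a.
pose F : {linear H -> A} := HB.pack (Defs.act X a) (GRing.isLinear.Build _ _ _ _ _ lr).
by rewrite -[LHS]/(F _) linear_sum; apply: eq_bigr => g _; rewrite linearZ.
Qed.

Lemma coactE a : coact X a = \sum_g tens (hcomp g a) (grp K g).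
Proof. exact: tensor_hcoef. Qed.

Lemma grpact1 a : grpact 1%g a = a.
Proof. exact: Defs.act1 modX a. Qed.

Lemma grpactM g h a : grpact (g * h)%g a = grpact h (grpact g a).
Proof. by rewrite /grpact -grpM (Defs.actM modX). Qed.

Lemma sum_hcomp a : \sum_g hcomp g a = a.
Proof.
rewrite -[RHS](coact_counit modX) coactE linear_sum; apply: eq_bigr => g _ /=.
have lf := @counitH_linear K gT.
by rewrite -[RHS]/(slicer _ _) slicer_tens // counitH_grp scale1r.
Qed.

Lemma hcomp_grpact g h a : hcomp g (grpact h a) = grpact h (hcomp g a).
Proof.
rewrite /hcomp {1}/grpact (coact_act modX) hcoef_tmap //.
exact: (act_bilinear modX).1.
Qed.

(** Coassociativity of the coaction, compared at the coefficient of [g] (x) [h]: one side is the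
    iterated component, while on the other the coproduct sends [h] to [h] (x) [h]. *)
Lemma hcomp_hcomp g h a : hcomp g (hcomp h a) = if g == h then hcomp h a else 0.
Proof.
(* [F] extracts the coefficient of [grp g] (x) [grp h]. *)
pose F : tensor A (tensor H H) -> A := slicer (fun s => (hcoef h s : H) g).
have lc : scalar (fun s : tensor H H => (hcoef h s : H) g : K).
  by move=> c x y; rewrite linearP !ffunE.
have lF : linear F by move=> c x y; rewrite /F linearP.
have lcoact := coact_linear modX.
have FE (w : H) (t : tensor A H) :
    F (tassoc (tens t w)) = (w h : K) *: hcoef g t.
  apply: (@tensor_ext_linear _ _ _ _ (fun t => F (tassoc (tens t w)))
    (fun t => (w h : K) *: hcoef g t)) => [||u v].
  - by move=> c x y; rewrite (tens_bilinear _ _).1 linearP lF.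
  - by move=> c x y; rewrite linearP /= scalerDr !scalerA mulrC.
  by rewrite tassoc_tens /F slicer_tens // hcoef_tens ffunE hcoef_tens scalerA.
have := congr1 F (coact_coassoc modX a).
have -> (t : tensor A H) :
    F (tassoc (tmap (coact X) id t)) = hcomp g (hcoef h t).
  apply: (@tensor_ext_linear _ _ _ _
    (fun t => F (tassoc (tmap (coact X) id t)))
    (fun t => hcomp g (hcoef h t))) => [||u v].
  - by move=> c x y; rewrite !linearP lF.
  - by move=> c x y; rewrite !linearP.
  by rewrite tmap_tens // FE hcoef_tens linearZ.
move=> ->.
have lcom := @comulH_linear K gT.
have -> (t : tensor A H) :
    F (tmap id (@comulH K gT) t) = (g == h)%:R *: hcoef h t.
  apply: (@tensor_ext_linear _ _ _ _ (fun t => F (tmap id (@comulH K gT) t))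
    (fun t => (g == h)%:R *: hcoef h t)) => [||u v].
  - by move=> c x y; rewrite linearP lF.
  - by move=> c x y; rewrite linearP /= scalerDr !scalerA mulrC.
  rewrite tmap_tens // /F slicer_tens // hcoef_comulH hcoef_tens !ffunE scalerA.
  congr (_ *: _); case: eqP => _.
    by rewrite mul1r; apply: mulr1.
  by rewrite mul0r; apply: mulr0.
by case: eqP => _; rewrite ?scale1r ?scale0r.
Qed.

Lemma tlift_mul a b : tlift (fun a b : A => a * b) (tens a b) = a * b.
Proof.
by rewrite tlift_tens //; split=> [y|x] c u v; rewrite ?mulrDl ?mulrDr
  -?scalerAl -?scalerAr.
Qed.

Lemma tlift_coact (V : vectType K) (b : A -> H -> V) a : bilinear_for *:%R *:%R b ->
  tlift b (coact X a) = \sum_g b (hcomp g a) (grp K g).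
Proof.
move=> bil; rewrite coactE linear_sum; apply: eq_bigr => g _ /=.
by rewrite tlift_tens.
Qed.

Lemma ydTensor_act_tens a b g :
  Defs.act (ydTensor X X) (tens a b) (grp K g) = tens (grpact g a) (grpact g b).
Proof.
have [al ar] := act_bilinear modX.
rewrite /= comulH_grp; set F := fun _ _ => _.
have FE w1 w2 : F w1 w2 = tens (Defs.act X a w1) (Defs.act X b w2).
  by rewrite /F tmap_tens.
rewrite tlift_tens ?FE //.
by split=> [w|v] c x y; rewrite !FE ar ((tens_bilinear _ _).1, (tens_bilinear _ _).2).
Qed.

Lemma ydTensor_coact_tens a b :
  coact (ydTensor X X) (tens a b)
    = \sum_h \sum_k tens (tens (hcomp h a) (hcomp k b)) (grp K (h * k)).
Proof.
have lcoact := coact_linear modX.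
have bil1 (v1 : A) (v2 : H) : bilinear_for *:%R *:%R
    (fun (w1 : A) (w2 : H) => tens (tens v1 w1) (v2 * w2)).
  apply: bilinear_tens => [c x y|c x y]; first exact: (tens_bilinear _ _).2.
  by rewrite mulrDr scalerAr.
have bil2 (t : tensor A H) : bilinear_for *:%R *:%R
    (fun (v1 : A) (v2 : H) =>
       tlift (fun (w1 : A) (w2 : H) => tens (tens v1 w1) (v2 * w2)) t).
  split=> [w|v] c x y; apply: tlift_funP => v' w'.
    by rewrite (tens_bilinear _ _).1 (tens_bilinear _ _).1.
  by rewrite mulrDl -scalerAl (tens_bilinear _ _).2.
rewrite /= tlift_tens; last first.
  split=> [w|v] c x y; rewrite lcoact; first exact: linearP.
  by apply: tlift_funP => v' w'; rewrite linearP.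
rewrite tlift_coact //; apply: eq_bigr => h _.
by rewrite tlift_coact //; apply: eq_bigr => k _; rewrite grpM.
Qed.

Lemma ydSigma_tens a b :
  ydSigma X X (tens a b) = \sum_g tens (hcomp g b) (grpact g a).
Proof.
have lcoact := coact_linear modX.
have [al ar] := act_bilinear modX.
rewrite /ydSigma tlift_tens; last first.
  split=> [w|v] c x y; last by rewrite lcoact linearP.
  by apply: tlift_funP => v' w'; rewrite al (tens_bilinear _ _).2.
rewrite tlift_coact //; split=> [w|v] c x y; first exact: (tens_bilinear _ _).1.
by rewrite ar (tens_bilinear _ _).2.
Qed.

Lemma hatmul_tens a a' b b' :
  hatmul X (tens a a') (tens b b')
    = \sum_g tens (a * hcomp g b) (grpact g a' * b').
Proof.
have lsig : linear (ydSigma X X) by exact: tlift_linear.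
have lmull (x : A) : linear (fun y : A => x * y).
  by move=> c y z; rewrite mulrDr scalerAr.
have lmulr (x : A) : linear (fun y : A => y * x).
  by move=> c y z; rewrite mulrDl scalerAl.
have bil1 (x x' : A) : bilinear_for *:%R *:%R (fun b b' : A =>
    tmap (fun y => x * y) (fun y => y * b') (ydSigma X X (tens x' b))).
  split=> [w|v] c y z; last first.
    apply: tlift_funP => v' w'.
    by rewrite mulrDr -scalerAr (tens_bilinear _ _).2.
  by rewrite (tens_bilinear _ _).2 lsig linearP.
rewrite /hatmul tlift_tens; last first.
  split=> [w|v] c y z; apply: tlift_funP => v' w'.
    by apply: tlift_funP => v'' w''; rewrite mulrDl -scalerAl (tens_bilinear _ _).1.
  by rewrite (tens_bilinear _ _).1 lsig linearP.
rewrite tlift_tens // ydSigma_tens linear_sum; apply: eq_bigr => g _ /=.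
by rewrite tmap_tens.
Qed.

Lemma grpactMr g a b : grpact g (a * b) = grpact g a * grpact g b.
Proof.
have [[_ mulact] _] := mul_morphism X.
by rewrite -tlift_mul {1}/grpact -mulact ydTensor_act_tens tlift_mul.
Qed.

Lemma grpact_1r g : grpact g 1 = 1.
Proof.
have [[_ unitact] _] := unit_morphism X.
have := unitact 1 (grp K g); rewrite /= scale1r /grpact => <-.
by rewrite counitH_grp mulr1 scale1r.
Qed.

Lemma hcompM g a b : hcomp g (a * b)
  = \sum_h \sum_k (if g == (h * k)%g then hcomp h a * hcomp k b else 0).
Proof.
have [_ /(_ (tens a b))] := mul_morphism X.
rewrite tlift_mul /hcomp => ->; rewrite hcoef_tmap; last exact: tlift_linear.
rewrite ydTensor_coact_tens (linear_sum (hcoef g)) linear_sum.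
apply: eq_bigr => h _; rewrite (linear_sum (hcoef g)) linear_sum.
apply: eq_bigr => k _ /=.
by rewrite hcoef_tens_grp; case: eqP => _; rewrite ?tlift_mul ?linear0.
Qed.

Lemma hcomp_1r g : hcomp g 1 = if g == 1%g then 1 else 0.
Proof.
have [_ /(_ (1 : K^o))] := unit_morphism X; rewrite /hcomp scale1r => ->.
have lin1 : linear (fun xi : K^o => (xi : K)%:A : A).
  by move=> c x y; rewrite scalerDl scalerA.
by rewrite hcoef_tmap //= hcoef_tens_grp; case: eqP => _; rewrite ?scale1r ?scale0r.
Qed.

Definition grouplike p := comul X p = tens p p /\ counit X p = 1.

Lemma grouplike_grpact g p : grouplike p -> grouplike (grpact g p).
Proof.
have [[_ comact] _] := comul_morphism X; have [[_ couact] _] := counit_morphism X.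
case=> Dp ep; split; first by rewrite {1}/grpact comact Dp ydTensor_act_tens.
by rewrite /grpact couact ep /= counitH_grp mulr1.
Qed.

(** Colinearity of the coproduct, read in degree [g]: the degree of [p_h] (x) [p_k] is [h k], which
    forces [k = h^-1 g]. *)
Lemma comul_hcomp g p : grouplike p -> comul X (hcomp g p)
  = \sum_h tens (hcomp h p) (hcomp (h^-1 * g) p).
Proof.
case=> Dp _; have [_ /(_ p)] := comul_morphism X.
rewrite Dp ydTensor_coact_tens => /(congr1 (hcoef g)).
rewrite hcoef_tmap; last exact: linearP.
rewrite -/(hcomp g p) => <-; rewrite linear_sum; apply: eq_bigr => h _.
rewrite linear_sum (bigD1 (h^-1 * g)%g) //= big1 => [|k kh].
  by rewrite hcoef_tens_grp mulKVg eqxx addr0.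
by rewrite hcoef_tens_grp -(inj_eq (mulgI (h^-1)%g)) mulKg eq_sym (negPf kh).
Qed.

(** The twist in the product of A (x) A keeps [p q] from being obviously group-like; all later
    arguments exploit this formula. *)
Lemma comul_mul p q : grouplike p -> grouplike q ->
  comul X (p * q) = \sum_g tens (p * hcomp g q) (grpact g p * q).
Proof. by case=> Dp _ [Dq _]; rewrite comulM Dp Dq hatmul_tens. Qed.

Lemma antipode_mulr p : grouplike p -> p * antipode X p = 1.
Proof.
case=> Dp ep; have := antipode_r X p; rewrite Dp ep scale1r tlift_tens //.
have [[lS _] _] := antipode_morphism X.
split=> [y|x] c u v; first by rewrite /= mulrDl -scalerAl.
by rewrite /= lS mulrDr -scalerAr.
Qed.

Lemma antipode_mull p : grouplike p -> antipode X p * p = 1.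
Proof.
case=> Dp ep; have := antipode_l X p; rewrite Dp ep scale1r tlift_tens //.
have [[lS _] _] := antipode_morphism X.
split=> [y|x] c u v; last by rewrite /= mulrDr -scalerAr.
by rewrite /= lS mulrDl -scalerAl.
Qed.

End YDHopf.

(** * A basis of group-like elements *)

Lemma closed_eigenvector (K : closedFieldType) (V : vectType K) (f : 'End(V))
    (C : {vspace V}) :
  C != 0%VS -> (f @: C <= C)%VS ->
  exists c v, [/\ v \in C, v != 0 & f v = c *: v].
Proof.
move=> C0 fC; set n := \dim C; pose b := vbasis C.
pose M : 'M[K]_n := \matrix_(i, j) coord b j (f b`_i).
(* The characteristic polynomial has degree [\dim C], which is positive, so it has a root. *)
have /closed_rootP[c] : size (char_poly M) != 1%N.
  by rewrite size_char_poly eqSS dimv_eq0.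
rewrite -eigenvalue_root_char => /eigenvalueP[u uM u0].
have bC (i : 'I_n) : b`_i \in C by rewrite vbasis_mem // mem_nth // size_tuple.
exists c, (\sum_i u 0 i *: b`_i); split.
- by rewrite rpred_sum // => i _; rewrite rpredZ.
- apply: contra_neq u0 => u0; apply/rowP => i; rewrite mxE.
  by have /freeP := basis_free (vbasisP C); apply.
rewrite linear_sum scaler_sumr.
under eq_bigr => i _.
  rewrite linearZ /= (coord_vbasis (subvP fC _ (memv_img f (bC i)))) scaler_sumr.
  over.
rewrite exchange_big; apply: eq_bigr => j _ /=.
rewrite scalerA; have /rowP/(_ j) := uM; rewrite !mxE => <-.
by rewrite scaler_suml; apply: eq_bigr => i _; rewrite scalerA mxE.
Qed.

Section Grouplikes.

Variables (K : fieldType) (gT : finGroupType) (A : falgType K) (X : ydHopf gT A).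
Hypothesis cocommX : cocommutative X.

(* [hit f a] is f(a_(1)) a_(2). *)
Definition hit (f : A -> K) a : A := slicel f (comul X a).

Lemma hit_linear f : linear (hit f).
Proof. by move=> c x y; rewrite /hit !linearP. Qed.

HB.instance Definition _ f := GRing.isLinear.Build K A A *:%R (hit f)
  (hit_linear f).

Lemma slicel_pairC (f h : A -> K) (t : tensor A A) : scalar f -> scalar h ->
  h (slicel f (tswap t)) = f (slicel h t).
Proof.
move=> lf lh; apply: (@tensor_ext_linear K A A K^o
  (fun t => h (slicel f (tswap t))) (fun t => f (slicel h t))) => [||u v].
- by move=> c x y; rewrite /tswap !linearP lh.
- by move=> c x y; rewrite linearP lf.
rewrite slicel_swap // slicer_tens // slicel_tens //.
by rewrite (scalar_forZ _ _ lf) (scalar_forZ _ _ lh) mulrC.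
Qed.

(** Both sides evaluate two functionals on a_(1) and a_(2) and keep a_(3); cocommutativity exchanges
    the first two. *)
Lemma hitC f h a : scalar f -> scalar h -> hit f (hit h a) = hit h (hit f a).
Proof.
move=> lf lh.
(* By coassociativity the iterated operator depends on the two functionals only through the
   coproduct of a_(1), where cocommutativity can be applied. *)
have hitE (e e' : A -> K) : scalar e -> scalar e' ->
    hit e' (hit e a) = slicel (fun x => e' (hit e x)) (comul X a).
  move=> le le'.
  have le2 : scalar (fun x => e' (hit e x)).
    by move=> c x y; rewrite linearP le'.
  have comulE (t : tensor A A) :
      comul X (slicel e t) = slicel e (tmap id (comul X) t).
    apply: (@tensor_ext_linear _ _ _ _ (fun t => comul X (slicel e t))
      (fun t => slicel e (tmap id (comul X) t))) => [||u v].
    - by move=> c x y; rewrite !linearP.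
    - by move=> c x y; rewrite !linearP.
    by rewrite tmap_tens ?slicel_tens ?linearZ //; apply: linearP.
  have assocE (s : tensor A A) w :
      slicel e' (slicel e (tassoc (tens s w))) = e' (slicel e s) *: w.
    apply: (@tensor_ext_linear _ _ _ _
      (fun s => slicel e' (slicel e (tassoc (tens s w))))
      (fun s => e' (slicel e s) *: w)) => [||u v].
    - by move=> c x y; rewrite (tens_bilinear _ _).1 !linearP.
    - by move=> c x y; rewrite linearP le' scalerDl scalerA.
    rewrite tassoc_tens !slicel_tens // linearZ /= slicel_tens // scalerA.
    by rewrite (scalar_forZ _ _ le').
  rewrite {1}/hit {1}/hit comulE -comul_coassoc.
  apply: (@tensor_ext_linear _ _ _ _
    (fun t => slicel e' (slicel e (tassoc (tmap (comul X) id t))))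
    (slicel (fun x => e' (hit e x)))) => [||u v].
  - by move=> c x y; rewrite !linearP.
  - exact: linearP.
  by rewrite tmap_tens ?assocE ?slicel_tens //; apply: linearP.
rewrite !hitE //; apply: eq_tlift => x w.
by rewrite /hit -slicel_pairC // cocommX.
Qed.

(** Left slices of the coproduct are values of [hit], and cocommutativity identifies the right
    slices with left ones. *)
Lemma subcoalgebra_hit (D : {vspace A}) :
  (forall f a, scalar f -> a \in D -> hit f a \in D) -> subcoalgebra X D.
Proof.
move=> Dhit c cD; apply: mem_tensv_slices => f lf; first exact: Dhit.
by rewrite -slicel_swap // cocommX; apply: Dhit.
Qed.

Lemma hit_subcoalgebra (D : {vspace A}) f a :
  subcoalgebra X D -> scalar f -> a \in D -> hit f a \in D.
Proof. by move=> subD lf /subD; apply: tensv_slicel. Qed.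

End Grouplikes.

(** The operators [hit X f] commute, so an eigenspace of one of them in [C] is a subcoalgebra and,
    by simplicity, all of [C]. Every such operator is therefore a scalar on [C], which makes the
    coproduct of a nonzero [v] in [C] a pure tensor and forces [C] to be a line. *)
Lemma simple_cocommutative (K : closedFieldType) (gT : finGroupType)
    (A : falgType K) (X : ydHopf gT A) (C : {vspace A}) :
  cocommutative X -> simple_subcoalgebra X C ->
  exists2 p, grouplike X p & C = <[p]>%VS.
Proof.
move=> cocommX [subC C0 simpleC].
have hit_scale (f : A -> K) : scalar f -> exists c, forall v, v \in C -> hit X f v = c *: v.
  move=> lf; pose F : 'End(A) := linfun (hit X f).
  have FC : (F @: C <= C)%VS.
    apply/subvP => _ /memv_imgP[v vC ->]; rewrite lfunE /=.
    exact: hit_subcoalgebra.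
  have [c [v [vC v0 Fv]]] := closed_eigenvector C0 FC.
  exists c => u uC; pose D := (C :&: lker (F - c *: \1%VF))%VS.
  have memD x : (x \in D) = (x \in C) && (hit X f x == c *: x).
    by rewrite memv_cap memv_ker !lfun_simp subr_eq0.
  have [||D0|DC] := simpleC D.
  - apply: subcoalgebra_hit => // h x lh; rewrite !memD => /andP[xC /eqP xE].
    by rewrite hit_subcoalgebra //= hitC // xE linearZ.
  - exact: capvSl.
  - have : v \in D by rewrite memD vC; move: Fv; rewrite lfunE /= => ->; apply: eqxx.
    by rewrite D0 memv0 (negPf v0).
  by move: uC; rewrite -{1}DC memD => /andP[_ /eqP].
pose v := vpick C; have v0 : v != 0 by rewrite vpick0.
have vC : v \in C by apply: memv_pick.
have [c cE] : exists c : 'I_(dim A) -> K, forall i, hit X (@rcoord K A i) v = c i *: v.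
  apply: (@fin_all_exists _ (fun=> K) (fun i c => hit X (@rcoord K A i) v = c *: v)) => i.
  by have [c /(_ v vC)] := hit_scale _ (@rcoord_scalar K A i); exists c.
(* The eigenvalues of the coordinate functionals are the coordinates of [w], so that the coproduct
   of [v] is [w] (x) [v]. *)
pose w := \sum_i c i *: r2v (delta_mx 0 i) : A.
have Dv : comul X v = tens w v.
  rewrite (tensor_slicel (comul X v)) tens_suml; apply: eq_bigr => i _.
  by rewrite -/(hit _ _ _) cE tensZr tensZl.
have lcounit : scalar (counit X) by exact: linearP.
have ew : counit X w = 1.
  have := counit_l X v; rewrite Dv -/(slicel _ _) slicel_tens // -{2}[v]scale1r.
  by move/eqP; rewrite -subr_eq0 -scalerBl scaler_eq0 (negPf v0) orbF subr_eq0 => /eqP.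
(* By cocommutativity [v] (x) [w] equals [w] (x) [v]; the counit on the first factor gives the
   claim, as [counit X w] is 1. *)
have vE : v = counit X v *: w.
  have := cocommX v; rewrite Dv => /(congr1 (slicel (counit X))).
  by rewrite slicel_swap // slicer_tens // slicel_tens // ew scale1r => /esym.
have ev0 : counit X v != 0 by apply: contraNneq v0 => e0; rewrite vE e0 scale0r.
have Dw : comul X w = tens w w.
  by apply: (scalerI ev0); rewrite -linearZ /= -vE Dv {1}vE tensZr.
have wC : w \in C.
  by rewrite -[w](scalerK ev0) -vE rpredZ.
exists w => //; apply/esym.
have w0 : w != 0 by apply: contraNneq v0 => w0; rewrite vE w0 scaler0.
have [||/eqP|//] := simpleC <[w]>%VS.
- move=> _ /vlineP[k ->]; rewrite linearZ /= Dw -tensZl.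
  by apply: mem_tensv; rewrite ?memvZ ?memv_line.
- by rewrite -memvE.
by rewrite -subv0 -memvE memv0 (negPf w0).
Qed.

(** Each simple summand is a line through a group-like element, and directness of the sum makes the
    number of summands equal to the dimension. *)
Lemma grouplike_basis (K : closedFieldType) (gT : finGroupType)
    (A : falgType K) (X : ydHopf gT A) :
  cocommutative X -> cosemisimple X ->
  exists n (b : n.-tuple A),
    basis_of fullv b /\ forall i : 'I_n, grouplike X b`_i.
Proof.
move=> cocommX [n [C [simpleC dC fC]]].
have [p pP] : exists p : 'I_n -> A, forall i, grouplike X (p i) /\ C i = <[p i]>%VS.
  apply: (@fin_all_exists _ (fun=> A) (fun i p => grouplike X p /\ C i = <[p]>%VS)).
  by move=> i; have [p] := simple_cocommutative cocommX (simpleC i); exists p.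
exists n, [tuple p i | i < n]; split=> [|i]; last first.
  by rewrite -tnth_nth tnth_mktuple; case: (pP i).
rewrite basisEdim size_tuple -fC; apply/andP; split.
  apply/subv_sumP => i _; rewrite (pP i).2 -memvE memv_span //.
  by apply/mapP; exists i => //; rewrite mem_enum.
rewrite (directvP dC) /= (eq_bigr (fun=> 1%N)) ?sum1_card ?card_ord // => i _.
have [_ + _] := simpleC i; rewrite (pP i).2 -dimv_eq0 dim_vline.
by case: (p i != 0).
Qed.

(** * The permuted basis of group-like elements and their degree groups *)

Section GrouplikeBasis.

Variables (K : fieldType) (gT : finGroupType) (abG : abelian [set: gT]).
Variables (A : falgType K) (X : ydHopf gT A) (n : nat) (b : n.-tuple A).
Hypotheses (basis_b : basis_of fullv b).
Hypothesis grouplike_b : forall i : 'I_n, grouplike X b`_i.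
Implicit Types (i j u t s : 'I_n) (g h k : gT) (a c : A).

Notation x_ i := (b`_(nat_of_ord i)).
Notation lam := (coord b).

Lemma coord_fullE a : a = \sum_u lam u a *: x_ u.
Proof. by apply: coord_basis basis_b (memvf a). Qed.

Lemma coord_x u i : lam u (x_ i) = (i == u)%:R.
Proof. exact/coord_free/basis_free/basis_b. Qed.

Lemma x_inj i j : x_ i = x_ j -> i = j.
Proof.
move=> xij; have := coord_x j i; rewrite xij coord_x eqxx.
by case: eqP => // _ /eqP; rewrite oner_eq0.
Qed.

Lemma comulE a : comul X a = \sum_u lam u a *: tens (x_ u) (x_ u).
Proof.
rewrite {1}(coord_fullE a) linear_sum; apply: eq_bigr => u _.
by rewrite linearZ /= (grouplike_b u).1.
Qed.

Lemma coord_scalar u : scalar (lam u).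
Proof. exact: linearP. Qed.
Hint Resolve coord_scalar : core.

Lemma slicel_comul u a : slicel (lam u) (comul X a) = lam u a *: x_ u.
Proof.
rewrite comulE linear_sum (bigD1 u) //= big1 => [|v vu]; rewrite linearZ /=.
  by rewrite slicel_tens // coord_x eqxx scale1r addr0.
by rewrite slicel_tens // coord_x (negPf vu) scale0r scaler0.
Qed.

Lemma slicer_comul u a : slicer (lam u) (comul X a) = lam u a *: x_ u.
Proof.
rewrite comulE linear_sum (bigD1 u) //= big1 => [|v vu]; rewrite linearZ /=.
  by rewrite slicer_tens // coord_x eqxx scale1r addr0.
by rewrite slicer_tens // coord_x (negPf vu) scale0r scaler0.
Qed.

(** Slicing the coproduct of [p] by a coordinate [lam u] that is nonzero at [p] gives [lam u p *: p]
    on one side and [lam u p *: x_ u] on the other. Hence the group permutes the basis, and 1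
    belongs to it. *)
Lemma grouplike_in_basis p : grouplike X p -> exists u : 'I_n, p = x_ u.
Proof.
case=> Dp ep; have [u pu] : exists u, lam u p != 0.
  apply/existsP; apply: contraTT isT; rewrite negb_exists => /forallP p0.
  have /eqP := ep; rewrite (coord_fullE p) big1 ?linear0 1?eq_sym ?oner_eq0 // => u _.
  by have:= p0 u; rewrite negbK => /eqP ->; rewrite scale0r.
exists u; apply: (scalerI pu).
by rewrite -slicel_comul Dp slicel_tens.
Qed.

Lemma grouplike_idx p : grouplike X p -> {u : 'I_n | p = x_ u}.
Proof. by move=> /grouplike_in_basis /sig_eqW. Qed.

Definition ga i g : 'I_n :=
  sval (grouplike_idx (grouplike_grpact g (grouplike_b i))).

Lemma gaE i g : x_ (ga i g) = grpact X g (x_ i).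
Proof. by rewrite /ga; case: grouplike_idx. Qed.

Lemma ga1 : ga^~ 1%g =1 id.
Proof. by move=> i; apply: x_inj; rewrite gaE grpact1. Qed.

Lemma gaM i : act_morph ga i.
Proof. by move=> g h; apply: x_inj; rewrite !gaE grpactM. Qed.

Definition gto := TotalAction ga1 gaM.

Lemma gaC i g h : ga (ga i g) h = ga (ga i h) g.
Proof. by rewrite -!gaM (centsP abG g _ h) ?inE. Qed.

Lemma coord_grpact u g a : lam (ga u g) (grpact X g a) = lam u a.
Proof.
rewrite {1}(coord_fullE a) !linear_sum (bigD1 u) //= big1 => [|v vu].
  by rewrite !linearZ /= -gaE coord_x eqxx mulr1 addr0.
rewrite !linearZ /= -gaE coord_x (inj_eq (@act_inj _ _ _ gto g)) (negPf vu).
by rewrite mulr0.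
Qed.

Definition degs i : {set gT} := [set g | hcomp X g (x_ i) != 0].

Lemma x_neq0 i : x_ i != 0.
Proof.
apply: contraTneq isT => x0; have /eqP := (grouplike_b i).2.
by rewrite x0 linear0 eq_sym oner_eq0.
Qed.

(** The coproduct of the component of degree [g h] contains the term [x_g] (x) [x_h], which
    projection of the first factor to degree [g] isolates and which is nonzero. *)
Lemma degsM i g h : g \in degs i -> h \in degs i -> (g * h)%g \in degs i.
Proof.
rewrite !inE => g0 h0; apply: contraTneq isT => gh0.
have := comul_hcomp (g * h) (grouplike_b i); rewrite gh0 linear0.
move/esym/(congr1 (tmap (hcomp X g) id)); rewrite linear0 linear_sum.
rewrite (bigD1 g) //= big1 => [|k kg].
  rewrite tmap_tens //; last exact: linearP.
  rewrite hcomp_hcomp eqxx addr0 mulKg => /eqP.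
  by rewrite (negPf (tens_neq0 g0 h0)).
rewrite tmap_tens //; last exact: linearP.
by rewrite hcomp_hcomp eq_sym (negPf kg) tens0l.
Qed.

Lemma degs_group_set i : group_set (degs i).
Proof.
apply/group_setP; split=> [|g h]; last exact: degsM.
have [g gD] : exists g, g \in degs i.
  apply/existsP; apply: contraTT isT; rewrite negb_exists => /forallP d0.
  have := x_neq0 i; rewrite -(sum_hcomp X (x_ i)) big1 ?eqxx // => g _.
  by have:= d0 g; rewrite inE negbK => /eqP.
(* Only positive powers are available at this point; the unit is reached as the power with exponent
   the order of [g]. *)
have powD m : (g ^+ m.+1)%g \in degs i.
  by elim: m => [|m IH]; rewrite ?expg1 // expgS degsM.
by have := powD #[g]%g.-1; rewrite prednK ?order_gt0 // expg_order.
Qed.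

Canonical degs_group i := group (degs_group_set i).

Lemma hcomp_notin i g : g \notin degs i -> hcomp X g (x_ i) = 0.
Proof. by rewrite inE negbK => /eqP. Qed.

Lemma grpact_inj g : injective (grpact X g).
Proof. by apply: (can_inj (g := grpact X g^-1)) => a; rewrite -grpactM mulgV grpact1. Qed.

Lemma degs_ga i g : degs (ga i g) = degs i.
Proof.
apply/setP => h; rewrite !inE gaE hcomp_grpact.
by rewrite -(inj_eq (@grpact_inj g) (hcomp X h (x_ i))) linear0.
Qed.

Definition xinv i : A := antipode X (x_ i).

Lemma mulVx i a : xinv i * (x_ i * a) = a.
Proof. by rewrite mulrA antipode_mull // mul1r. Qed.

Lemma mulxV i a : a * x_ i * xinv i = a.
Proof. by rewrite -mulrA antipode_mulr // mulr1. Qed.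

Lemma mulx_unit i : x_ i \is a GRing.unit.
Proof.
by apply/unitrP; exists (xinv i); rewrite antipode_mull ?antipode_mulr.
Qed.

(* The components of [a] of degree in the coset {h | x_i.h = x_t}. *)
Definition pt i t a := \sum_(h | ga i h == t) hcomp X h a.

Lemma pt_linear i t : linear (pt i t).
Proof.
move=> c a a'; rewrite /pt scaler_sumr -big_split; apply: eq_bigr => h _.
by rewrite linearP.
Qed.

HB.instance Definition _ i t := GRing.isLinear.Build K A A *:%R (pt i t)
  (pt_linear i t).

Lemma sum_pt i a : \sum_t pt i t a = a.
Proof. by rewrite -[RHS](sum_hcomp X) (partition_big (ga i) predT). Qed.

Lemma hcomp_pt i t g a :
  hcomp X g (pt i t a) = if ga i g == t then hcomp X g a else 0.
Proof.
rewrite /pt linear_sum; case: eqP => [gt|ngt].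
  rewrite (bigD1 g) ?gt //= hcomp_hcomp eqxx big1 ?addr0 // => h /andP[_ hg].
  by rewrite /= hcomp_hcomp eq_sym (negPf hg).
rewrite big1 // => h /eqP ht; rewrite /= hcomp_hcomp.
by case: eqP => // gh; rewrite gh in ngt.
Qed.

Lemma pt_pt i t s a : pt i t (pt i s a) = if s == t then pt i t a else 0.
Proof.
rewrite /pt; under eq_bigr => h _ do rewrite -/(pt i s a) hcomp_pt.
case: eqP => [->|st]; first by apply: eq_bigr => h ->.
by rewrite big1 // => h /eqP ->; case: eqP => // ts; case: st.
Qed.

Definition orb i j : {set 'I_n} := orbit gto (degs j) i.

(** Components of distinct degrees cannot cancel, so the part is nonzero exactly when its coset
    meets [degs j]. *)
Lemma pt_orb i j t : (pt i t (x_ j) != 0) = (t \in orb i j).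
Proof.
apply/idP/orbitP => [|[g gD <-]].
  move=> p0; have /existsP[g /andP[/eqP gt gD]] :
      [exists g, (ga i g == t) && (g \in degs j)].
    apply: contraNT p0; rewrite negb_exists => /forallP nt.
    rewrite /pt big1 // => h ht; apply: hcomp_notin.
    by have := nt h; rewrite ht.
  by exists g.
apply: contraTneq gD => p0; rewrite inE negbK.
by have := hcomp_pt i (ga i g) g (x_ j); rewrite eqxx p0 linear0 => <-.
Qed.

(** * Supports of products of group-like elements *)

(** The coproduct of [x_ i * x_ j] is computed by [comul_mul], with the terms grouped by
    [t = ga i g], and also diagonally in the basis; the two results are sliced by [lam u] in the
    first factor. [comul_xx_r] slices the second factor. *)
Lemma comul_xx_l i j u :
  \sum_t lam u (x_ i * pt i t (x_ j)) *: (x_ t * x_ j)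
    = lam u (x_ i * x_ j) *: x_ u.
Proof.
rewrite -slicel_comul comul_mul // linear_sum (partition_big (ga i) predT) //=.
apply: eq_bigr => t _; rewrite /pt mulr_sumr linear_sum scaler_suml.
by apply: eq_bigr => g /eqP <-; rewrite slicel_tens // -gaE.
Qed.

Lemma comul_xx_r i j u :
  \sum_t lam u (x_ t * x_ j) *: (x_ i * pt i t (x_ j))
    = lam u (x_ i * x_ j) *: x_ u.
Proof.
rewrite -slicer_comul comul_mul // linear_sum (partition_big (ga i) predT) //=.
apply: eq_bigr => t _; rewrite /pt mulr_sumr scaler_sumr.
by apply: eq_bigr => g /eqP <-; rewrite slicer_tens // -gaE.
Qed.

Definition supp i j : {set 'I_n} := [set u | lam u (x_ i * x_ j) != 0].

(** Cancelling [x_ j] on the right in [comul_xx_l] leaves a vanishing combination of the basis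
    elements [x_ t], so each coefficient is 0. *)
Lemma supp_pt0 i j u t : u \notin supp i j -> lam u (x_ i * pt i t (x_ j)) = 0.
Proof.
rewrite inE negbK => /eqP u0; have := comul_xx_l i j u; rewrite u0 scale0r.
move/(congr1 (fun a => lam t (a * xinv j))); rewrite mul0r linear0 mulr_suml.
rewrite linear_sum (bigD1 t) //= big1 => [|s st]; rewrite /= -scalerAl mulxV linearZ /=.
  by rewrite coord_x eqxx mulr1 addr0.
by rewrite coord_x (negPf st) mulr0.
Qed.

(** Cancelling [x_ i] on the left in [comul_xx_r] leaves a sum over the parts of [x_ j], from which
    [pt i t] selects one. *)
Lemma pt_inv i j t u :
  lam u (x_ t * x_ j) *: pt i t (x_ j)
    = lam u (x_ i * x_ j) *: pt i t (xinv i * x_ u).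
Proof.
have := congr1 (fun a => pt i t (xinv i * a)) (comul_xx_r i j u).
rewrite /= -scalerAr linearZ /= => <-; rewrite mulr_sumr [RHS]linear_sum.
rewrite [RHS](bigD1 t) //= [X in _ + X]big1 => [|s st];
  rewrite /= -scalerAr mulVx linearZ /= pt_pt.
  by rewrite eqxx addr0.
by rewrite (negPf st) scaler0.
Qed.

(** If [u] is missing from [supp i j], the right side of [pt_inv] vanishes, while the part
    [pt i t (x_ j)] on the left does not. *)
Lemma supp_orb_sub i j t : t \in orb i j -> supp t j \subset supp i j.
Proof.
rewrite -pt_orb => p0; apply/subsetP => u; rewrite !inE; apply: contraNneq => u0.
have /eqP := pt_inv i j t u.
by rewrite u0 scale0r scaler_eq0 (negPf p0) orbF.
Qed.

Lemma supp_orb i j t : t \in orb i j -> supp t j = supp i j.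
Proof.
move=> tT; apply/eqP; rewrite eqEsubset supp_orb_sub //= supp_orb_sub //.
by rewrite /orb orbit_sym.
Qed.

Definition spn (S : {set 'I_n}) : {vspace A} := <<[seq x_ i | i in S]>>%VS.

Lemma mem_spn (S : {set 'I_n}) i : i \in S -> x_ i \in spn S.
Proof. by move=> iS; apply: memv_span; apply: image_f. Qed.

Lemma spn_sub (S : {set 'I_n}) (W : {vspace A}) :
  (forall i, i \in S -> x_ i \in W) -> (spn S <= W)%VS.
Proof. by move=> SW; apply/span_subvP => _ /imageP[i iS ->]; apply: SW. Qed.

Lemma dim_spn (S : {set 'I_n}) : \dim (spn S) = #|S|.
Proof.
have /eqP : free (image_tuple (fun i : 'I_n => x_ i) S).
  apply/freeP => c c0 k; have := congr1 (lam (enum_val k)) c0.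
  rewrite linear0 linear_sum (bigD1 k) //= big1 => [|m mk]; rewrite linearZ /= nth_image.
    by rewrite coord_x eqxx mulr1 addr0.
  by rewrite coord_x (inj_eq enum_val_inj) (negPf mk) mulr0.
by rewrite size_tuple.
Qed.

(** Right multiplication by the unit [x_ j] maps the span of the orbit onto that of the support:
    [comul_xx_l] writes [x_ u] through the products [x_ t * x_ j], and [supp_orb] confines these
    products to the support. *)
Lemma card_supp i j : #|supp i j| = #|orb i j|.
Proof.
rewrite -!dim_spn -[RHS](@limg_dim_eq _ _ _ (amulr (x_ j))); last first.
  by rewrite (eqP (lker0_amulr (mulx_unit j))) capv0.
congr (\dim _); apply/eqP; rewrite eqEsubv; apply/andP; split.
  apply: spn_sub => u uC; have u0 : lam u (x_ i * x_ j) != 0 by rewrite inE in uC.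
  rewrite -[x_ u](scalerK u0) -comul_xx_l rpredZ // rpred_sum // => t _.
  have [tT|] := boolP (t \in orb i j).
    rewrite rpredZ //; have := memv_img (amulr (x_ j)) (mem_spn tT).
    by rewrite lfunE.
  rewrite -pt_orb negbK => /eqP ->.
  by rewrite mulr0 linear0 scale0r mem0v.
apply/subvP => _ /memv_imgP[a aT ->]; rewrite lfunE /=.
suff: (spn (orb i j) <= amulr (x_ j) @^-1: spn (supp i j))%VS.
  by move/subvP/(_ a aT); rewrite -memv_preim lfunE.
apply: spn_sub => t tT; rewrite -memv_preim lfunE /=.
rewrite [_ * _]coord_fullE rpred_sum // => u _.
have [uC|] := boolP (u \in supp t j).
  by rewrite rpredZ // mem_spn // -(supp_orb tT).
by rewrite inE negbK => /eqP ->; rewrite scale0r mem0v.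
Qed.

(** * Products whose support contains the unit *)

Variable e : 'I_n.
Hypothesis e1 : x_ e = 1.

Lemma ga_e g : ga e g = e.
Proof. by apply: x_inj; rewrite gaE e1 grpact_1r. Qed.

Lemma stab_fix i g : g \in 'C[i | gto]%g -> grpact X g (x_ i) = x_ i.
Proof. by move/astab1P => /= gi; rewrite -gaE [ga i g]gi. Qed.

Lemma fix_stab i g : grpact X g (x_ i) = x_ i -> g \in 'C[i | gto]%g.
Proof. by move=> gi; apply/astab1P/x_inj; rewrite -[RHS]gi -gaE. Qed.

Lemma orb_fix i j t g :
  g \in 'C[i | gto]%g -> t \in orb i j -> grpact X g (x_ t) = x_ t.
Proof.
move=> /astab1P /= gi /orbitP[h _ <-]; rewrite -gaE /=.
by rewrite gaC [ga i g]gi.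
Qed.

(** At [u = e], cancelling [x_ j] in [comul_xx_l] writes its inverse as a combination of [x_ t] with
    [t] in the orbit of [i]. As the group is abelian, the stabilizer of [i] fixes all of these,
    hence also [x_ j]. *)
Lemma stab_sub i j : e \in supp i j -> 'C[i | gto]%g \subset 'C[j | gto]%g.
Proof.
move=> eC; apply/subsetP => g gi.
have e0 : lam e (x_ i * x_ j) != 0 by rewrite inE in eC.
have inv_fix : grpact X g (xinv j) = xinv j.
  apply: (scalerI e0).
  have: \sum_t lam e (x_ i * pt i t (x_ j)) *: x_ t = lam e (x_ i * x_ j) *: xinv j.
    have := congr1 (fun a => a * xinv j) (comul_xx_l i j e).
    rewrite /= e1 -scalerAl mul1r => <-; rewrite mulr_suml.
    by apply: eq_bigr => t _; rewrite -scalerAl mulxV.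
  rewrite -linearZ /= => <-; rewrite linear_sum; apply: eq_bigr => t _.
  rewrite linearZ /=; have [tT|] := boolP (t \in orb i j).
    by rewrite (orb_fix gi tT).
  by rewrite -pt_orb negbK => /eqP ->; rewrite mulr0 linear0 !scale0r.
apply: fix_stab; apply: (mulrI (x := xinv j)).
  by apply/unitrP; exists (x_ j); rewrite antipode_mull ?antipode_mulr.
by rewrite -{1}inv_fix -grpactMr antipode_mull // grpact_1r.
Qed.

(** By [comul_xx_l], [x_ u] is a combination of products [x_ t * x_ j] with [t] in the orbit of [i];
    both factors are fixed by the stabilizer of [i]. *)
Lemma supp_stab i j u : e \in supp i j -> u \in supp i j ->
  'C[i | gto]%g \subset 'C[u | gto]%g.
Proof.
move=> eC uC; apply/subsetP => g gi.
have gj := subsetP (stab_sub eC) g gi.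
have u0 : lam u (x_ i * x_ j) != 0 by rewrite inE in uC.
apply: fix_stab; apply: (scalerI u0); rewrite -linearZ /= -comul_xx_l.
rewrite linear_sum; apply: eq_bigr => t _.
rewrite linearZ /=; have [tT|] := boolP (t \in orb i j).
  by rewrite grpactMr (orb_fix gi tT) (stab_fix gj).
by rewrite -pt_orb negbK => /eqP ->; rewrite mulr0 linear0 !scale0r.
Qed.

(** The case [u = e] of [pt_inv]. Up to a nonzero scalar the part does not depend on [j], which
    allows a comparison of two different [j]. *)
Lemma pt_inv_e i j t : e \in supp i j -> t \in orb i j ->
  exists2 c : K, c != 0 & pt i t (x_ j) = c *: pt i t (xinv i).
Proof.
move=> eC tT; have := eC; rewrite -(supp_orb tT) !inE => et0.
have ei0 : lam e (x_ i * x_ j) != 0 by rewrite inE in eC.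
exists ((lam e (x_ t * x_ j))^-1 * lam e (x_ i * x_ j)).
  by rewrite mulf_neq0 ?invr_eq0.
have := pt_inv i j t e; rewrite e1 mulr1 => /(canRL (scalerK et0)) ->.
by rewrite scalerA.
Qed.

(** With [j' = ga j g], the translate of [supp i j] by [g] is [supp (ga i g) j'], which equals
    [supp i j'] since [ga i g] is in the orbit of [i]. The parts of [x_ j] and [x_ j'] are
    proportional by [pt_inv_e], so [supp i j'] lies in [supp i j]. *)
Lemma supp_degs i j u g : e \in supp i j -> g \in degs j -> u \in supp i j ->
  ga u g \in supp i j.
Proof.
move=> eC gD uC; set j' := ga j g.
have orbE : orb i j' = orb i j by rewrite /orb /degs_group /= degs_ga.
have suppE : supp i j' = supp (ga i g) j'.
  by apply/esym/supp_orb; rewrite orbE; apply: mem_orbit.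
have supp_ga v : (ga v g \in supp (ga i g) j') = (v \in supp i j).
  by rewrite !inE !gaE -grpactMr coord_grpact.
have eC' : e \in supp i j' by rewrite suppE -(ga_e g) supp_ga.
have : ga u g \in supp i j' by rewrite suppE supp_ga.
apply: contraTT => gu; rewrite inE negbK -[x_ j'](sum_pt i) mulr_sumr linear_sum.
rewrite big1 // => t _; have [tT|] := boolP (t \in orb i j).
  have tT' : t \in orb i j' by rewrite orbE.
  have [c c0 cE] := pt_inv_e eC tT; have [c' _ ->] := pt_inv_e eC' tT'.
  rewrite -(canLR (scalerK c0) cE) scalerA -scalerAr linearZ /=.
  by rewrite (supp_pt0 t gu) mulr0.
by rewrite -orbE -pt_orb negbK => /eqP ->; rewrite mulr0 linear0.
Qed.

(* [card_supp] makes the degs j-orbit of u strictly smaller than that of i. *)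
Lemma stab_proper i j : e \in supp i j -> ~~ (degs j \subset 'C[i | gto]%g) ->
  exists2 u, u != e & 'C[i | gto]%g \proper 'C[u | gto]%g.
Proof.
move=> eC nD.
have [u /andP[ue uC]] : exists u, (u != e) && (u \in supp i j).
  apply/existsP; apply: contraNT nD; rewrite negb_exists => /forallP ne.
  (* If [e] were the only element of the support, [card_supp] would reduce the orbit of [i] to a
     point, and [degs j] would fix [i]. *)
  have orb_le1 : (#|orb i j| <= 1)%N.
    rewrite -card_supp -(cards1 e) subset_leq_card //.
    apply/subsetP => u uC; have := ne u; rewrite uC andbT negbK.
    by rewrite !inE.
  apply/subsetP => g gD; apply/astab1P.
  by apply: (card_le1_eqP orb_le1); rewrite ?orbit_refl // mem_orbit.
exists u => //; rewrite properEneq (supp_stab eC uC) andbT.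
apply: contraTneq isT => CE.
have: (#|orb u j| < #|orb i j|)%N.
  rewrite -[X in (_ < X)%N]card_supp (cardsD1 e (supp i j)) eC add1n ltnS.
  apply: subset_leq_card.
  apply/subsetP => _ /orbitP[g gD <-]; apply/setD1P; split.
    by apply: contra_neq ue => /= ge; apply: (@act_inj _ _ _ gto g); rewrite /= ge ga_e.
  exact: supp_degs.
by rewrite /orb !card_orbit CE ltnn.
Qed.

(** * The trivial Yetter-Drinfel'd Hopf subalgebra attached to a subgroup *)

Section TrivialPart.

Variable V : {set gT}.

(** Both conditions refer to the same [V], so that every degree occurring in one element acts
    trivially on any other; this turns the quasisymmetry into the flip. *)
Definition core : {set 'I_n} :=
  [set p | (V \subset 'C[p | gto]%g) && (degs p \subset V)].

Lemma coreP i : reflect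
  ((forall g, g \in V -> grpact X g (x_ i) = x_ i) /\
   (forall g, g \notin V -> hcomp X g (x_ i) = 0)) (i \in core).
Proof.
rewrite inE; apply: (iffP andP) => [[/subsetP VC /subsetP DV]|[fixV degV]].
  split=> g; first by move/VC/stab_fix.
  by move=> gV; apply: hcomp_notin; apply: contra gV; apply: DV.
split; apply/subsetP => g; first by move/fixV/fix_stab.
by apply: contraLR => /degV g0; rewrite inE g0 eqxx.
Qed.

Lemma spn_linear (W : vectType K) (f f' : A -> W) (S : {set 'I_n}) a :
  linear f -> linear f' -> (forall i, i \in S -> f (x_ i) = f' (x_ i)) ->
  a \in spn S -> f a = f' a.
Proof.
move=> lf lf' ff'.
pose F : {linear A -> W} := HB.pack f (GRing.isLinear.Build _ _ _ _ f lf).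
pose F' : {linear A -> W} := HB.pack f' (GRing.isLinear.Build _ _ _ _ f' lf').
suff /subvP SW : (spn S <= lker (linfun F - linfun F'))%VS.
  by move=> /SW; rewrite memv_ker !lfun_simp subr_eq0 => /eqP.
by apply: spn_sub => i /ff' E; rewrite memv_ker !lfun_simp subr_eq0 /= E.
Qed.

Lemma spn_linear_sub (W : vectType K) (f : A -> W) (U : {vspace W})
    (S : {set 'I_n}) a :
  linear f -> (forall i, i \in S -> f (x_ i) \in U) -> a \in spn S -> f a \in U.
Proof.
move=> lf fU.
pose F : {linear A -> W} := HB.pack f (GRing.isLinear.Build _ _ _ _ f lf).
suff /subvP SW : (spn S <= linfun F @^-1: U)%VS.
  by move=> /SW; rewrite -memv_preim lfunE.
by apply: spn_sub => i /fU fi; rewrite -memv_preim lfunE.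
Qed.

Lemma core_e : 1%g \in V -> e \in core.
Proof.
move=> V1; apply/coreP; split=> g gV; rewrite e1 ?grpact_1r // hcomp_1r.
by case: eqP gV => // ->; rewrite V1.
Qed.

(** Only degrees [g] in [V] contribute to [comul_mul], and these fix [x_ i]; the components of
    [x_ j] then sum up to [x_ j], and the product is group-like. *)
Lemma core_mul i j : group_set V -> i \in core -> j \in core ->
  exists2 k, k \in core & x_ i * x_ j = x_ k.
Proof.
move=> gV /coreP[fixi degi] /coreP[fixj degj].
pose G := group gV.
have gl : grouplike X (x_ i * x_ j).
  split; last by rewrite counitM !(grouplike_b _).2 mulr1.
  rewrite comul_mul //.
  under eq_bigr => g _.
    have -> : tens (x_ i * hcomp X g (x_ j)) (grpact X g (x_ i) * x_ j)
        = tens (x_ i * hcomp X g (x_ j)) (x_ i * x_ j).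
      have [/fixi-> //|/degj->] := boolP (g \in V).
      by rewrite mulr0 !tens0l.
    over.
  by rewrite -tens_suml -mulr_sumr sum_hcomp.
have [k kE] := grouplike_idx gl; exists k => //; apply/coreP.
rewrite -kE; split=> g gG; first by rewrite grpactMr fixi ?fixj.
rewrite hcompM big1 // => h _; rewrite big1 // => m _; case: eqP => // gE.
have [hV|/degi->] := boolP (h \in V); last by rewrite mul0r.
have [mV|/degj->] := boolP (m \in V); last by rewrite mulr0.
by move: gG; rewrite gE (groupM (G := G)).
Qed.

(** Left multiplication by [x_ i] is an injective self-map of the finite set [core], hence
    surjective, and so takes the value 1. *)
Lemma core_inv i : group_set V -> i \in core ->
  exists2 k, k \in core & xinv i = x_ k.
Proof.
move=> gV iP.
have V1 : 1%g \in V := group1 (group gV).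
(* The default [e] is never reached for [j] in [core], where the product is a basis element by
   [core_mul]. *)
pose m j : 'I_n := odflt e [pick k | x_ i * x_ j == x_ k].
have mE j : j \in core -> x_ (m j) = x_ i * x_ j.
  move=> jP; have [k kP kE] := core_mul gV iP jP.
  by rewrite /m; case: pickP => [k' /eqP-> //|/(_ k)]; rewrite kE eqxx.
have minj : {in core &, injective m}.
  move=> j j' jP jP' mjj; apply: x_inj.
  by rewrite -(mulVx i (x_ j)) -mE // mjj mE // mulVx.
have msub : m @: core \subset core.
  apply/subsetP => _ /imsetP[j jP ->]; have [k kP kE] := core_mul gV iP jP.
  by rewrite (_ : m j = k) //; apply: x_inj; rewrite mE.
have /eqP mE' : m @: core == core by rewrite eqEcard msub card_in_imset /=.
have : e \in m @: core by rewrite mE' core_e.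
move=> /imsetP[k kP ek]; exists k => //.
by rewrite -[RHS](mulVx i) -mE // -ek e1 mulr1.
Qed.

(** A basis element occurring in a component of [x_ i] is, by slicing [comul_hcomp], itself a
    combination of components of [x_ i]. It is thus fixed by [V] and has its degrees in [V]. *)
Lemma hcomp_core g i : i \in core -> hcomp X g (x_ i) \in spn core.
Proof.
move=> /coreP[fixi degi]; rewrite [hcomp _ _ _]coord_fullE rpred_sum // => u _.
have [->|u0] := eqVneq (lam u (hcomp X g (x_ i))) 0; first by rewrite scale0r mem0v.
rewrite rpredZ // mem_spn //; apply/coreP.
have uE : x_ u = (lam u (hcomp X g (x_ i)))^-1 *:
    \sum_h lam u (hcomp X h (x_ i)) *: hcomp X (h^-1 * g) (x_ i).
  apply: (canRL (scalerK u0)); rewrite -slicel_comul comul_hcomp // linear_sum.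
  by apply: eq_bigr => h _; rewrite /= slicel_tens.
split=> h hV; rewrite uE linearZ /=; last first.
  rewrite (linear_sum (hcomp X h)) [X in _ *: X]big1 ?scaler0 // => k _.
  by rewrite linearZ /= hcomp_hcomp; case: eqP => [<-|_];
    rewrite ?(degi h hV) scaler0.
rewrite (linear_sum (grpact X h)); congr (_ *: _); apply: eq_bigr => k _.
by rewrite linearZ /= -hcomp_grpact fixi.
Qed.

Lemma core_ydHopf_sub : group_set V -> ydHopf_sub X (spn core).
Proof.
move=> gV; have V1 : 1%g \in V := group1 (group gV).
have lmull (x : A) : linear (fun y : A => x * y).
  by move=> c y z; rewrite mulrDr scalerAr.
have lmulr (x : A) : linear (fun y : A => y * x).
  by move=> c y z; rewrite mulrDl scalerAl.
have [[lS _] _] := antipode_morphism X.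
split.
- by rewrite -e1 mem_spn // core_e.
- move=> a c aB; apply: spn_linear_sub => // j jP; move: aB.
  apply: (spn_linear_sub (f := fun y => y * x_ j)) => // i iP.
  by have [k kP ->] := core_mul gV iP jP; apply: mem_spn.
- move=> c; apply: spn_linear_sub => [|i iP]; first exact: linearP.
  by rewrite (grouplike_b i).1; apply: mem_tensv; apply: mem_spn.
- move=> c h cB; rewrite actE rpred_sum // => g _; rewrite rpredZ //.
  move: cB; apply: spn_linear_sub => [|i /coreP[fixi degi]]; first exact: linearP.
  rewrite -gaE mem_spn //; apply/coreP; split=> k kV; rewrite gaE.
    (* Commutativity of the group makes the translate of a [V]-fixed element [V]-fixed again. *)
    by rewrite -grpactM (centsP abG g _ k) ?inE // grpactM fixi.
  by rewrite hcomp_grpact degi ?linear0.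
- move=> c cB; rewrite coactE rpred_sum // => g _.
  apply: mem_tensv; rewrite ?memvf //; move: cB.
  by apply: spn_linear_sub => [|i iP]; [exact: linearP | exact: hcomp_core].
move=> c; apply: spn_linear_sub => // i iP.
by have [k kP] := core_inv gV iP; rewrite /xinv => ->; apply: mem_spn.
Qed.

(** In the sum for the quasisymmetry, a degree in [V] acts trivially on the other factor, and the
    component of a degree outside [V] vanishes. *)
Lemma core_trivial : yd_trivial X (spn core).
Proof.
move=> a a' aB aB'; rewrite ydSigma_tens -[in RHS](sum_hcomp X a') tens_suml.
apply: eq_bigr => g _; have [gV|gV] := boolP (g \in V).
  congr tens; move: aB; apply: spn_linear => // [|i /coreP[fixi _]].
    exact: linearP.
  exact: fixi.
have -> : hcomp X g a' = 0; last by rewrite !tens0l.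
move: aB'; apply: (spn_linear (f' := fun=> 0)) => [||i /coreP[_ degi]].
- exact: linearP.
- by move=> k x y; rewrite scaler0 addr0.
exact: degi.
Qed.

End TrivialPart.

(** * Choice of a maximal stabilizer *)

Lemma trivial_ydHopf_sub : (1 < n)%N ->
  exists B : {vspace A}, [/\ ydHopf_sub X B, yd_trivial X B & (1 < \dim B)%N].
Proof.
move=> n1.
have /existsP[i0 i0e] : [exists i, i != e].
  apply: contraTT n1; rewrite negb_exists -leqNgt => /forallP ie.
  rewrite -{1}(card_ord n) -(cards1 e) -cardsT subset_leq_card //.
  by apply/subsetP => i _; have := ie i; rewrite negbK inE.
case: (arg_maxnP (P := fun i => i != e) (fun i => #|'C[i | gto]%g|) i0e) => i ie imax.
(* The product of [x_ i] with its inverse has coordinate 1 at [e]; expanding the inverse in the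
   basis, some term must contribute. *)
have [j eC] : exists j, e \in supp i j.
  apply/existsP; apply: contraT; rewrite negb_exists => /forallP sC.
  have := congr1 (lam e) (antipode_mulr (grouplike_b i)).
  rewrite -/(xinv i) (coord_fullE (xinv i)) mulr_sumr linear_sum -e1 coord_x eqxx.
  rewrite big1 => [/eqP|j _]; first by rewrite eq_sym oner_eq0.
  have := sC j; rewrite inE negbK => /eqP cij.
  by rewrite -scalerAr linearZ /= cij mulr0.
pose V : {set gT} := 'C[i | gto]%g.
have gV : group_set V := groupP _.
(* Otherwise [stab_proper] yields [u != e] with a larger stabilizer, against the maximality of
   [i]. *)
have DV : degs j \subset V.
  apply: contraT => /(stab_proper eC)[u ue /proper_card].
  by rewrite ltnNge (imax u ue : (_ <= _)%N).
exists (spn (core V)); split; [exact: core_ydHopf_sub | exact: core_trivial |].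
rewrite dim_spn.
(* For [j = e] the product is [x_ i] itself, whose support does not contain [e]. *)
have je : j != e.
  apply: contraNneq ie => je; move: eC.
  by rewrite je inE e1 mulr1 coord_x; case: (i == e) => //; rewrite eqxx.
have <- : #|[set j; e]| = 2%N by rewrite cards2 je.
rewrite subset_leq_card // subUset !sub1set core_e ?(group1 (group gV)) // andbT.
by rewrite inE DV stab_sub.
Qed.

End GrouplikeBasis.

Theorem proposition2 (K : closedFieldType) (charK : [pchar K] =i pred0)
    (gT : finGroupType) (abG : abelian [set: gT])
    (A : falgType K) (X : ydHopf gT A)
    (cocommA : cocommutative X) (cossA : cosemisimple X)
    (dimA : (1 < \dim {:A})%N) :
  exists B : {vspace A},
    [/\ ydHopf_sub X B, yd_trivial X B & (1 < \dim B)%N].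
Proof.
have [n [b [basis_b grouplike_b]]] := grouplike_basis cocommA cossA.
have gl1 : grouplike X 1 by split; [exact: comul1 | exact: counit1].
have [e e1] := grouplike_in_basis basis_b grouplike_b gl1.
apply: (trivial_ydHopf_sub abG basis_b grouplike_b (esym e1)).
by rewrite -(size_basis basis_b).
Qed.
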